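(* Suppose $g$ is concave. Then an equilibrium exists.
   Context: Setting: $E$ is a finite set with $N$ elements and $X=(X_n)_{n\in\mathbb N_0}$ is a time-homogeneous Markov chain on $E$; under $\mathbb P_x$ (expectation $\mathbb E_x$) one has $X_0=x$ a.s. The chain is absorbing: from every $x\in E$ some absorbing state is reached with positive probability in finitely many steps. $(Y_n)_{n\in\mathbb N_0}$ are i.i.d. uniform on $[0,1]$ and independent of $X$. $f,h:E\to\mathbb R$ are functions and $g:\mathbb R\to\mathbb R$ is continuous. Vectors in $\mathbb R^N$ are identified with functions on $E$: $\mathbf p=(p_x)_{x\in E}$. A (mixed) stopping strategy is a vector $\mathbf p\in[0,1]^N$; its stopping time is $\tau_{\mathbf p}=\min\{n\ge0: Y_n\le p_{X_n}\}$ ($=\infty$ if there is no such $n$). Convention: on $\{\tau=\infty\}$, $f(X_\tau):=\lim_{n\to\infty}f(X_n)$ and $h(X_\tau):=\lim_{n\to\infty}h(X_n)$ (the limits exist a.s. because $X$ is absorbing). Notation: $\phi_{\mathbf p}(x)=\mathbb E_x(f(X_{\tau_{\mathbf p}}))$, $\psi_{\mathbf p}(x)=\mathbb E_x(h(X_{\tau_{\mathbf p}}))$, $J_{\mathbf p}(x)=\phi_{\mathbf p}(x)+g(\psi_{\mathbf p}(x))$. A stopping strategy $\hat{\mathbf p}\in[0,1]^N$ is an equilibrium if for all $q\in[0,1]$ and all $x\in E$, $$J_{\hat{\mathbf p}}(x)\ge q f(x)+(1-q)\mathbb E_x(\phi_{\hat{\mathbf p}}(X_1))+g\big(q h(x)+(1-q)\mathbb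 E_x(\psi_{\hat{\mathbf p}}(X_1))\big).$$ *)

(* Defs.v *)
From mathcomp Require Import all_boot all_order all_algebra.
From mathcomp Require Import all_classical all_reals all_analysis.
Import Order.TTheory GRing.Theory Num.Theory.
Import numFieldNormedType.Exports.

Set Implicit Arguments.
Unset Strict Implicit.
Unset Printing Implicit Defensive.

Local Open Scope classical_set_scope.
Local Open Scope ring_scope.

Definition concave_function (R : realType) (g : R -> R) : Prop :=
  convex_function [set: R^o] (fun x : R^o => - g x).

Section Chain.
Context (R : realType) (E : finType) (d : measure_display)
  (Omega : measurableType d).
Variables (P : E -> probability Omega R) (X : nat -> Omega -> E).

Definition transition (y z : E) : \bar R := P y (X 1%N @^-1` [set z]).

(* The third clause is the Markov property with a time-independent kernel,
   P_x(X_{n+1} = e_{n+1} | X_0 = e_0, ..., X_n = e_n) = P_{e_n}(X_1 = e_{n+1}),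
   multiplied by the probability of the conditioning event. *)
Definition homogeneous_markov_chain : Prop :=
  [/\ forall n (y : E), measurable (X n @^-1` [set y]),
      forall x, P x (X 0%N @^-1` [set x]) = 1%E &
      forall x (n : nat) (e : nat -> E),
        P x [set w | forall i, (i <= n.+1)%N -> X i w = e i] =
        (P x [set w | forall i, (i <= n)%N -> X i w = e i] *
         transition (e n) (e n.+1))%E].

Definition absorbing_state (y : E) : Prop := transition y y = 1%E.

Definition absorbing_chain : Prop :=
  forall x, exists y, absorbing_state y /\
    exists n, (0 < P x (X n @^-1` [set y]))%E.

End Chain.

Section Randomization.
Context (R : realType) (E : finType) (d : measure_display)
  (Omega : measurableType d).
Variables (mu : probability Omega R).

Definition iid_uniform (Y : nat -> {mfun Omega >-> R}) : Prop :=
  (forall n (B : set R), measurable B ->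
     distribution mu (Y n) B = uniform_prob (@ltr01 R) B) /\
  (forall (J : seq nat) (B : nat -> set R), uniq J ->
     (forall i, measurable (B i)) ->
     mu (\bigcap_(i in [set` J]) (Y i @^-1` B i)) =
     (\prod_(i <- J) mu (Y i @^-1` B i))%E).

(* E carries the discrete sigma-algebra. *)
Definition sigma_X (X : nat -> Omega -> E) : set (set Omega) :=
  <<s \bigcup_n preimage_set_system setT (X n) [set: set E] >>.

Definition sigma_Y (Y : nat -> {mfun Omega >-> R}) : set (set Omega) :=
  <<s \bigcup_n preimage_set_system setT (Y n) (@measurable _ R) >>.

Definition independent_sequences (X : nat -> Omega -> E)
    (Y : nat -> {mfun Omega >-> R}) : Prop :=
  forall A B, sigma_X X A -> sigma_Y Y B ->
    mu (A `&` B) = (mu A * mu B)%E.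

End Randomization.

Section Stopping.
Context (R : realType) (E : finType) (d : measure_display)
  (Omega : measurableType d).
Variables (P : E -> probability Omega R) (X : nat -> Omega -> E)
  (Y : nat -> {mfun Omega >-> R}).

Definition strategy (p : E -> R) : Prop := forall x, 0 <= p x <= 1.

(* None stands for the value infinity. *)
Definition stopping_time (p : E -> R) (w : Omega) : option nat :=
  match pselect (exists n, Y n w <= p (X n w)) with
  | left ex => Some (ex_minn ex)
  | right _ => None
  end.

Definition stopped_value (f : E -> R) (p : E -> R) (w : Omega) : R :=
  match stopping_time p w with
  | Some n => f (X n w)
  | None => lim (f (X n w) @[n --> \oo])
  end.

(* Only applied to random variables that are a.s. bounded, E being finite. *)
Definition expect (x : E) (Z : Omega -> R) : R := fine ('E_(P x)[Z])%E.

(* phi is value f, psi is value h *)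
Definition value (f : E -> R) (p : E -> R) (x : E) : R :=
  expect x (stopped_value f p).

Definition reward (f h : E -> R) (g : R -> R) (p : E -> R) (x : E) : R :=
  value f p x + g (value h p x).

Definition equilibrium (f h : E -> R) (g : R -> R) (p : E -> R) : Prop :=
  strategy p /\
  forall (q : R) (x : E), 0 <= q <= 1 ->
    q * f x + (1 - q) * expect x (value f p \o X 1%N)
    + g (q * h x + (1 - q) * expect x (value h p \o X 1%N))
    <= reward f h g p x.

End Stopping.

(* Main.v *)
(* By the Markov property, q |-> q f(x) + (1 - q) E_x phi_p(X_1) + g(...) at q = p x
   is J_p(x), so an equilibrium is a Nash equilibrium of the game in which each
   state x chooses p x in [0, 1] and receives this payoff, concave in q.
   The payoff depends continuously on p: the value phi_p solves
   phi x = p x f x + (1 - p x) E_x phi(X_1) with phi = f on absorbing states, and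
   the chain killed on absorption is a strict contraction after finitely many
   steps. A Nash equilibrium is then obtained from Kuhn's cubical Sperner lemma,
   itself proved by a mod 2 Stokes argument: the cup product of the differentials
   of the labels is exact, so its sum over the grid only depends on the boundary,
   where the labels are prescribed. *)
Require Import Defs.
From mathcomp Require Import all_boot all_order all_algebra.
From mathcomp Require Import all_classical all_reals all_analysis.
From mathcomp Require Import measurable_realfun.
From mathcomp Require Import ring lra.
Import Order.TTheory GRing.Theory Num.Theory.
Import numFieldNormedType.Exports.

Set Implicit Arguments.
Unset Strict Implicit.
Unset Printing Implicit Defensive.

Local Open Scope ring_scope.

Definition update (A : eqType) (B : Type) (z : A -> B) a i : A -> B :=
  fun y => if y == a then i else z y.

(** * Kuhn's lemma *)

Section Kuhn.
Context (E : finType).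
Implicit Types (S : {set E}) (z : E -> nat) (a b : E) (l : (E -> nat) -> bool).

Definition step z a : E -> nat := fun y => (z y + (y == a))%N.

(* The mod 2 cup product of the differentials of the 0-cochains in [L], evaluated
   on the cube with lowest vertex [z] and edge directions [S]. *)
Fixpoint cup S (L : seq ((E -> nat) -> bool)) z : bool :=
  if L is l :: L' then
    \sum_(a in S) (l (step z a) + l z) * cup (S :\ a) L' (step z a)
  else 1.

Lemma stepC z a b : step (step z a) b = step (step z b) a.
Proof. by apply: funext => y; rewrite /step addnAC. Qed.

Lemma setD1C S a b : S :\ a :\ b = S :\ b :\ a.
Proof. by apply/finset.setP => x; rewrite !inE andbCA. Qed.

Lemma addbb_ring (x : bool) : x + x = 0.
Proof. by case: x. Qed.

Lemma sum_offdiagC S (F : E -> E -> bool) :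
  \sum_(a in S) \sum_(b in S :\ a) F a b = \sum_(a in S) \sum_(b in S :\ a) F b a.
Proof.
rewrite [RHS](exchange_big_dep (fun b => b \in S)) /=; last first.
  by move=> a b _ /finset.setD1P[].
apply: eq_bigr => a aS; apply: eq_bigl => b.
by rewrite !inE aS eq_sym andbC andbT.
Qed.

Lemma sum_offdiagD S (F G : E -> E -> bool) :
  \sum_(a in S) \sum_(b in S :\ a) (F a b + G a b) =
  \sum_(a in S) \sum_(b in S :\ a) F a b + \sum_(a in S) \sum_(b in S :\ a) G a b.
Proof. by rewrite -big_split; apply: eq_bigr => a _; rewrite -big_split. Qed.

(** The terms at [(a, b)] and [(b, a)] are equal and cancel mod 2; ranking [E] picks one
    representative [G] of each unordered pair. *)
Lemma sum_offdiag_sym S (F : E -> E -> bool) : (forall a b, F a b = F b a) ->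
  \sum_(a in S) \sum_(b in S :\ a) F a b = 0.
Proof.
move=> Fsym; pose G a b := (enum_rank a < enum_rank b)%N && F a b.
have -> : \sum_(a in S) \sum_(b in S :\ a) F a b =
    \sum_(a in S) \sum_(b in S :\ a) (G a b + G b a).
  apply: eq_bigr => a aS; apply: eq_bigr => b /finset.setD1P[ba bS].
  rewrite /G (Fsym b a); case: ltngtP => [_|_|/val_inj/enum_rank_inj ab].
  - by case: (F a b).
  - by case: (F a b).
  - by rewrite ab eqxx in ba.
under eq_bigr do rewrite big_split.
rewrite big_split /= [X in _ + X]sum_offdiagC; exact: addbb_ring.
Qed.

(** A cup product of coboundaries is a cocycle: its values on the facets of a cube, upper at
    [step z a] and lower at [z], add up to zero. In the induction, expanding both kinds of facets
    along a second direction [b] gives [T1 + T2] and [T3 + T4]. *)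
Lemma cup_closed L S z :
  \sum_(a in S) (cup (S :\ a) L (step z a) + cup (S :\ a) L z) = 0.
Proof.
elim: L S z => [|l L IH] S z /=; first by rewrite big1.
pose T1 a b := l (step (step z a) b) * cup (S :\ a :\ b) L (step (step z a) b).
pose T2 a b := l (step z a) * cup (S :\ a :\ b) L (step (step z a) b).
pose T3 a b := l (step z b) * cup (S :\ a :\ b) L (step z b).
pose T4 a b := l z * cup (S :\ a :\ b) L (step z b).
(* [T5] does not come from the expansion. It is symmetric in [a] and [b], so it sums to zero, and it
   completes [T4] to an instance of the induction hypothesis at [z]. Likewise [T2] pairs with the
   transpose of [T3] at [step z a]. *)
pose T5 a b := l z * cup (S :\ a :\ b) L z.
have T1s : \sum_(a in S) \sum_(b in S :\ a) T1 a b = 0.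
  by apply: sum_offdiag_sym => a b; rewrite /T1 setD1C stepC.
have T5s : \sum_(a in S) \sum_(b in S :\ a) T5 a b = 0.
  by apply: sum_offdiag_sym => a b; rewrite /T5 setD1C.
have T23 : \sum_(a in S) \sum_(b in S :\ a) (T2 a b + T3 b a) = 0.
  apply: big1 => a aS.
  rewrite (eq_bigr (fun b => l (step z a) * (cup (S :\ a :\ b) L (step (step z a) b)
     + cup (S :\ a :\ b) L (step z a)))) => [|b _].
    by rewrite -mulr_sumr IH mulr0.
  by rewrite mulrDr /T3 setD1C.
have T45 : \sum_(a in S) \sum_(b in S :\ a) (T4 a b + T5 a b) = 0.
  apply: big1 => a aS; under eq_bigr do rewrite -mulrDr.
  by rewrite -mulr_sumr IH mulr0.
transitivity (\sum_(a in S) \sum_(b in S :\ a) (T1 a b + T2 a b + (T3 a b + T4 a b))).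
  apply: eq_bigr => a aS; rewrite -big_split; apply: eq_bigr => b _ /=.
  by rewrite !mulrDl.
move: T23 T45; rewrite !sum_offdiagD T1s T5s addr0 add0r => T23 ->.
by rewrite addr0 [X in _ + X]sum_offdiagC.
Qed.

(* The cup product of the differentials of [l :: L] is the differential of
   [l] times the cup product of the differentials of [L]. *)
Lemma cup_exact l L S z : cup S (l :: L) z =
  \sum_(a in S) (l (step z a) * cup (S :\ a) L (step z a)
                 + l z * cup (S :\ a) L z).
Proof.
apply/eqP; rewrite -subr_eq0 /= -sumrB.
rewrite (eq_bigr (fun a => l z * (cup (S :\ a) L (step z a) + cup (S :\ a) L z))).
  by rewrite -mulr_sumr cup_closed mulr0.
by move=> a _; case: (l _) (l z) (cup _ _ _) (cup _ _ _) => [] [] [] [].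
Qed.

(** The edges with directions in [S] keep coordinate [a] fixed, so the differential of [l] vanishes
    on all of them, and every term of the product contains such a factor. *)
Lemma cup_const S L l z a : l \in L -> a \notin S ->
  (forall u v, u a = z a -> v a = z a -> l u = l v) -> cup S L z = 0.
Proof.
elim: L S z => // l' L IH S z; rewrite inE => /orP[/eqP <-|lL] aS lz /=.
  apply: big1 => b bS; rewrite (lz (step z b) z) ?addbb_ring ?mul0r //.
  rewrite /step; case: eqP => [ab|_]; last by rewrite addn0.
  by rewrite ab bS in aS.
apply: big1 => b bS; rewrite IH ?mulr0 //; first by rewrite inE (negPf aS) andbF.
have -> // : step z b a = z a.
rewrite /step; case: eqP => [ab|_]; last by rewrite addn0.
by rewrite ab bS in aS.
Qed.

(** A nonzero term of the expanded product is a monotone edge path in the cube along which each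
    label of [L] changes across its own edge. *)
Lemma cup_neq0 S L l z : cup S L z -> l \in L ->
  exists u v, [/\ forall y, (z y <= u y <= (z y).+1)%N,
    forall y, (z y <= v y <= (z y).+1)%N, l u = false & l v = true].
Proof.
(* For the induction the vertices may move only in the directions of [S]: the subcube at [step z a]
   with directions [S :\ a] then stays inside the cube at [z]. *)
suff H : cup S L z -> l \in L -> exists u v,
    [/\ forall y, (z y <= u y <= z y + (y \in S))%N,
    forall y, (z y <= v y <= z y + (y \in S))%N, l u = false & l v = true].
  move=> /H {}H /H[u [v [zu zv lu lv]]]; exists u, v; split=> // y.
    have /andP[-> /leq_trans] := zu y; apply.
    by rewrite -addn1 leq_add2l leq_b1.
  have /andP[-> /leq_trans] := zv y; apply.
  by rewrite -addn1 leq_add2l leq_b1.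
elim: L S z => // l' L IH S z Sz; rewrite inE.
have [a /andP[aS]] : exists a, (a \in S) &&
    ((l' (step z a) + l' z) * cup (S :\ a) L (step z a)).
  apply/existsP/contraT => /existsPn no; move: Sz => /=.
  by rewrite big1 // => a aS; move: (no a); rewrite aS /=; case: (_ * _).
have za y : (z y <= step z a y <= z y + (y \in S))%N.
  rewrite /step leq_addr leq_add2l /=; case: eqP => [->|//]; by rewrite aS.
have zz y : (z y <= z y <= z y + (y \in S))%N by rewrite leqnn leq_addr.
rewrite mulrC => /andP[cS]; rewrite addrC => dl /orP[/eqP ->|lL].
  move: dl; case l1: (l' z); case l2: (l' (step z a)) => // _.
    by exists (step z a), z.
  by exists z, (step z a).
have [u [v [zu zv lu lv]]] := IH _ _ cS lL.
have ext (w : E -> nat) :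
   (forall y, (step z a y <= w y <= step z a y + (y \in S :\ a))%N) ->
   forall y, (z y <= w y <= z y + (y \in S))%N.
  move=> zw y; have := zw y; rewrite /step !inE; case: eqP => [->|_] /=.
    by rewrite aS addn0 => /andP[/(leq_trans _)-> //]; rewrite leq_addr.
  by rewrite addn0.
by exists u, v; split=> //; apply: ext.
Qed.

Fixpoint boxsum (k : nat) (s : seq E) (F : (E -> nat) -> bool) z : bool :=
  if s is a :: s' then \sum_(i < k) boxsum k s' F (update z a i) else F z.

Lemma updateC z a b i j : a != b ->
  update (update z a i) b j = update (update z b j) a i.
Proof.
move=> ab; apply: funext => y; rewrite /update.
by case: eqP => // ->; rewrite eq_sym (negPf ab).
Qed.

Lemma boxsum_update k s F z a i : a \notin s ->
  boxsum k s F (update z a i) = boxsum k s (fun z' => F (update z' a i)) z.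
Proof.
elim: s z => //= b s IH z; rewrite inE negb_or => /andP[ab as_].
by apply: eq_bigr => j _; rewrite updateC // IH.
Qed.

Lemma eq_boxsum k s F G z : F =1 G -> boxsum k s F z = boxsum k s G z.
Proof. by move=> FG; elim: s z => //= b s IH z; apply: eq_bigr => j _. Qed.

Lemma boxsum_sum (I : finType) (A : pred I) k s (F : I -> (E -> nat) -> bool) z :
  boxsum k s (fun z' => \sum_(i in A) F i z') z =
  \sum_(i in A) boxsum k s (F i) z.
Proof.
elim: s z => //= b s IH z; rewrite exchange_big /=.
by apply: eq_bigr => j _; rewrite IH.
Qed.

(** Makes the sum over coordinate [a] innermost, where it can telescope. *)
Lemma boxsum_rem k s a F z : uniq s -> a \in s ->
  boxsum k s F z = boxsum k (rem a s) (fun z' => \sum_(i < k) F (update z' a i)) z.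
Proof.
elim: s z => //= b s IH z /andP[bs us]; rewrite inE eq_sym.
case: eqP => [<- _|ab /= as_].
  rewrite (boxsum_sum predT).
  by apply: eq_bigr => i _; rewrite boxsum_update.
by apply: eq_bigr => j _; rewrite IH.
Qed.

Lemma boxsum_neq0 k s F z : uniq s -> boxsum k s F z ->
  exists z', [/\ F z', forall a, a \in s -> (z' a < k)%N &
    forall a, a \notin s -> z' a = z a].
Proof.
elim: s z => [|b s IH] z /=; first by exists z.
move=> /andP[bs us] Fz.
have [i Fi] : exists i : 'I_k, boxsum k s F (update z b i).
  apply/existsP/contraT => /existsPn no; move: Fz.
  by rewrite big1 // => i _; move: (no i); case: (boxsum _ _ _ _).
have [z' [Fz' lt eq]] := IH _ us Fi; exists z'; split=> // a; rewrite inE.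
  by case: eqP => [-> _|_ /lt//]; rewrite eq // /update eqxx.
by case: eqP => //= ab /eq ->; rewrite /update; case: eqP.
Qed.

Lemma telescope_update k (G : (E -> nat) -> bool) z a :
  \sum_(i < k) (G (step (update z a i) a) + G (update z a i)) =
  G (update z a k) + G (update z a 0%N).
Proof.
have su i : step (update z a i) a = update z a i.+1.
  apply: funext => y; rewrite /step /update; case: eqP => //; first by rewrite addn1.
  by rewrite addn0.
elim: k => [|k IH]; first by rewrite big_ord0 addbb_ring.
rewrite big_ord_recr /= IH su.
by case: (G _) (G _) (G _) => [] [] [].
Qed.

(** Discrete Stokes and induction on [s]: by [cup_exact] the sum telescopes in each direction to two
    opposite faces of the box. In direction [b] the lower face vanishes with [lab b], and on the
    upper face [lab b] is 1, which leaves the sum for the remaining coordinates. All other faces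
    contribute zero. *)
Lemma boxsum_cup k (lab : E -> (E -> nat) -> bool) s z : uniq s ->
  (forall a z, z a = 0%N -> lab a z = false) ->
  (forall a z, z a = k -> lab a z = true) ->
  boxsum k s (cup [set x in s] [seq lab a | a <- s]) z = 1.
Proof.
move=> us lab0 labk; elim: s us z => [//|b s IH] /andP[bs us] z.
pose S := [set x in b :: s].
pose G a z := lab b z * cup (S :\ a) [seq lab a | a <- s] z.
transitivity (\sum_(a in S) boxsum k (b :: s) (fun z => G a (step z a) + G a z) z).
  rewrite -(boxsum_sum (mem S)); apply: eq_boxsum => z'; exact: cup_exact.
have GE a : a \in S ->
    boxsum k (b :: s) (fun z => G a (step z a) + G a z) z =
    boxsum k (rem a (b :: s)) (fun z => G a (update z a k) + G a (update z a 0%N)) z.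
  rewrite inE => aS; rewrite (@boxsum_rem _ _ a) ?[uniq _]/= ?bs//.
  by apply: eq_boxsum => z'; rewrite telescope_update.
have bS : b \in S by rewrite !inE eqxx.
have Sb : S :\ b = [set x in s].
  apply/finset.setP => x; rewrite !inE; case: eqP => //= ->; by rewrite (negPf bs).
rewrite (bigD1 b) //= [X in _ + X]big1 ?addr0 => [|a /andP[aS ab]].
  have := GE _ bS; rewrite [LHS]/= => ->; rewrite /= eqxx -(IH us (update z b k)).
  rewrite boxsum_update //; apply: eq_boxsum => z'; rewrite /G Sb.
  rewrite labk ?lab0 /update ?eqxx // mul0r addr0; exact: mul1r.
have as_ : a \in s by move: aS; rewrite !inE (negPf ab).
have := GE _ aS; rewrite [LHS]/= => ->.
(* On a face in a direction [a] other than [b], the label [lab a] is constant but is still a factor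
   of the product. *)
have G0 z' i : i = 0%N \/ i = k -> G a (update z' a i) = 0.
  move=> ik; rewrite /G (@cup_const _ _ (lab a) _ a) ?mulr0 //.
  - by apply: map_f.
  - by rewrite !inE eqxx.
  - rewrite /update eqxx => u v ua va.
    by case: ik ua va => -> ua va; [rewrite !lab0|rewrite !labk].
(* The summand is zero; written as an empty sum, it lets [boxsum_sum] make the whole box sum
   empty. *)
rewrite (@eq_boxsum _ _ _ (fun z' => \sum_(i in (pred0 : pred 'I_0)) false)) => [|z'].
  by rewrite boxsum_sum big_pred0.
by rewrite big_pred0 // !G0 ?addr0//; [left|right].
Qed.

(** The cup product of all labels has odd sum over the grid, so it is nonzero on some cube, and
    there every label takes both values. *)
Lemma kuhn_cubical k (lab : E -> (E -> nat) -> bool) :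
  (forall a z, z a = 0%N -> lab a z = false) ->
  (forall a z, z a = k -> lab a z = true) ->
  exists z, (forall a, (z a < k)%N) /\
    forall a, exists u v, [/\ forall y, (z y <= u y <= (z y).+1)%N,
      forall y, (z y <= v y <= (z y).+1)%N, lab a u = false & lab a v = true].
Proof.
move=> lab0 labk; have := boxsum_cup (fun=> 0%N) (enum_uniq E) lab0 labk.
move=> /idP /(boxsum_neq0 (enum_uniq E))[z [cz zk _]]; exists z; split=> a.
  by rewrite zk // mem_enum.
by apply: cup_neq0 cz _; apply/map_f; rewrite mem_enum.
Qed.

End Kuhn.

(** * Stopping along the chain *)

Local Open Scope classical_set_scope.

(** * Finite-horizon stopping games with an abstract stopping rule *)

Section Game.
Context (R : realType) (E : finType) (d : measure_display)
  (Omega : measurableType d) (mu : probability Omega R).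
Variables (X : nat -> Omega -> E) (stop : nat -> E -> set Omega).
Variables (K : E -> E -> R) (p c r : E -> R).

Definition path_event n (e : nat -> E) : set Omega :=
  [set w | forall i, (i <= n)%N -> X i w = e i].

(** The rule is evaluated along the fixed path [e] instead of [X]; for threshold rules the event
    then depends on [Y] alone. *)
Definition no_stop n (e : nat -> E) : set Omega :=
  [set w | forall i, (i < n)%N -> ~ stop i (e i) w].

Hypothesis mX : forall n y, measurable (X n @^-1` [set y]).
Hypothesis mstop : forall n y, measurable (stop n y).
Hypothesis markov : forall n e, mu (path_event n.+1 e) =
  (mu (path_event n e) * (K (e n) (e n.+1))%:E)%E.
Hypothesis indep_stop : forall n k e, mu (path_event n e `&` no_stop k e) =
  (mu (path_event n e) * (\prod_(i < k) (1 - p (e i)))%:E)%E.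

(* The payoff when the scan starts at time [j] and at most [k] further steps are
   allowed: [r] when stopped, [c] when the horizon is reached. *)
Fixpoint game k j w : R :=
  if k is k'.+1 then
    if `[< stop j (X j w) w >] then r (X j w) else game k' j.+1 w
  else c (X j w).

Fixpoint game_value k x : R :=
  if k is k'.+1 then p x * r x + (1 - p x) * \sum_z K x z * game_value k' z
  else c x.

Lemma measurable_path_event n e : measurable (path_event n e).
Proof.
rewrite (_ : path_event n e = \bigcap_(i in [set i | (i <= n)%N]) (X i @^-1` [set e i])) //.
by apply: bigcap_measurableType => i _; exact: mX.
Qed.

Lemma measurable_no_stop n e : measurable (no_stop n e).
Proof.
rewrite (_ : no_stop n e = \bigcap_(i in [set i | (i < n)%N]) ~` stop i (e i)) //.
by apply: bigcap_measurableType => i _; apply/measurableC/mstop.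
Qed.

(** As [E] is finite, the event is a finite union of pieces on which [X j] is constant. *)
Lemma measurable_slice j (B : E -> set Omega) :
  (forall y, measurable (B y)) -> measurable [set w | B (X j w) w].
Proof.
move=> mB; rewrite (_ : [set w | _] = \bigcup_(y in [set: E]) (X j @^-1` [set y] `&` B y)).
  by apply: fin_bigcup_measurable => // y _; apply: measurableI.
apply/seteqP; split=> w /=; first by exists (X j w).
by move=> [y _ [/= <-]].
Qed.

Lemma measurable_state j (u : E -> R) : measurable_fun setT (fun w => u (X j w)).
Proof.
move=> _ B mB; rewrite setTI.
apply: (@measurable_slice j (fun y => [set w | B (u y)])) => y.
have [By|nBy] := pselect (B (u y)).
  by rewrite (_ : [set w | _] = setT) //; apply/seteqP; split.
by rewrite (_ : [set w | _] = set0) //; apply/seteqP; split.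
Qed.

Lemma measurable_game k j : measurable_fun setT (game k j).
Proof.
elim: k j => [|k IH] j /=; first exact: measurable_state.
apply: measurable_fun_ifT => //; last exact: measurable_state.
apply: (measurable_fun_bool true); rewrite setTI.
rewrite (_ : _ @^-1` _ = [set w | stop j (X j w) w]); first exact: measurable_slice.
by apply/seteqP; split => w /= /asboolP.
Qed.

Lemma game_bounded M : (forall x, `|c x| <= M) -> (forall x, `|r x| <= M) ->
  forall k j w, `|game k j w| <= M.
Proof. by move=> cM rM; elim=> //= k IH j w; case: ifP. Qed.

Let surv j e := path_event j e `&` no_stop j e.
Let weight j e : R := fine (mu (path_event j e)) * \prod_(i < j) (1 - p (e i)).

Let msurv j e : measurable (surv j e).
Proof. by apply: measurableI; [exact: measurable_path_event|exact: measurable_no_stop]. Qed.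

Let mu_fin A : measurable A -> mu A = (fine (mu A))%:E.
Proof. by move=> mA; rewrite fineK // fin_num_measure. Qed.

Let int_cst A (a : R) : measurable A ->
  (\int[mu]_(w in A) cst a%:E w = (a * fine (mu A))%:E)%E.
Proof.
move=> mA; rewrite integral_cst // EFinM.
exact: (congr1 (fun x => a%:E * x)%E (mu_fin mA)).
Qed.

Let mu_surv j e : mu (surv j e) = (weight j e)%:E.
Proof.
by rewrite /surv indep_stop mu_fin ?EFinM //; exact: measurable_path_event.
Qed.

Let weightS j e z : weight j.+1 (update e j.+1 z) =
  weight j e * (1 - p (e j)) * K (e j) z.
Proof.
have eqe i : (i <= j)%N -> update e j.+1 z i = e i.
  by rewrite /update => ij; rewrite ltn_eqF.
have -> : weight j.+1 (update e j.+1 z) =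
    fine (mu (path_event j e)) * K (e j) z * \prod_(i < j.+1) (1 - p (e i)).
  rewrite /weight; congr (_ * _); last first.
    by apply: eq_bigr => i _; rewrite eqe // -ltnS.
  rewrite markov (_ : path_event j _ = path_event j e).
    rewrite [in LHS]mu_fin; last exact: measurable_path_event.
    by rewrite -EFinM /= eqe // /update eqxx.
  by apply/seteqP; split=> w /= H i ij; rewrite H // eqe.
by rewrite big_ord_recr /= /weight; ring.
Qed.

(** Induction on the horizon. The event of following [e] unstopped up to time [j] splits into
    stopping at [j], which pays [r (e j)], and continuing to some state [z], where the induction
    hypothesis applies to [e] extended by [z]. *)
Lemma integral_game k j e :
  (\int[mu]_(w in path_event j e `&` no_stop j e) (game k j w)%:E =
  (fine (mu (path_event j e)) * \prod_(i < j) (1 - p (e i)) *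
   game_value k (e j))%:E)%E.
Proof.
rewrite -/(surv j e) -/(weight j e).
elim: k j e => [|k IH] j e.
  rewrite (eq_integral (cst (c (e j))%:E)) => [|w].
    by rewrite int_cst // mu_surv mulrC.
  by rewrite inE => -[/(_ j (leqnn j)) Xj _]; rewrite /= Xj.
pose A := surv j e `&` stop j (e j).
pose D := \big[setU/set0]_(z <- enum E) surv j.+1 (update e j.+1 z).
have eqe z i : (i <= j)%N -> update e j.+1 z i = e i.
  by rewrite /update => ij; rewrite ltn_eqF.
have DE w : D w <-> surv j e w /\ ~ stop j (e j) w.
  rewrite /D -bigcup_seq; split.
    move=> [z _ [Pz Nz]]; split; [split|].
    - by move=> i ij; rewrite Pz ?eqe // leqW.
    - by move=> i ij; rewrite -(eqe z) ?(ltnW ij)//; apply: Nz; rewrite ltnS ltnW.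
    - by rewrite -(eqe z) //; apply: Nz.
  move=> [[Pz Nz] nst]; exists (X j.+1 w); first by rewrite /= mem_enum.
  split=> i.
    rewrite leq_eqVlt => /orP[/eqP ->|]; first by rewrite /update eqxx.
    by rewrite ltnS => ij; rewrite eqe // Pz.
  rewrite ltnS => ij; rewrite eqe //.
  by move: ij; rewrite leq_eqVlt => /orP[/eqP ->//|]; exact: Nz.
have mA : measurable A by apply: measurableI.
have mD : measurable D by apply: bigsetU_measurable => z _; exact: msurv.
have AD : surv j e = A `|` D.
  apply/seteqP; split=> w.
    by move=> sw; have [st|st] := pselect (stop j (e j) w); [left|right; apply/DE].
  by move=> [[]//|/DE[]].
have dAD : [disjoint A & D].
  by apply/disj_setPS => w [[_ st] /DE[]].
(* The hypothesis [indep_stop] gives probabilities of not stopping only, so the mass of [A] is found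
   by subtracting that of [D]. *)
have muA : mu A = (weight j e * p (e j))%:E.
  have muD : mu D = (weight j e * (1 - p (e j)))%:E.
    rewrite (_ : D = path_event j e `&` no_stop j.+1 e).
      rewrite indep_stop mu_fin; last exact: measurable_path_event.
      by rewrite -EFinM big_ord_recr /= mulrA.
    apply/seteqP; split=> w.
      move=> /DE[[P N] st]; split => // i; rewrite ltnS leq_eqVlt.
      by move=> /orP[/eqP ->//|]; exact: N.
    move=> [P N]; apply/DE; split; last exact: N.
    by split=> // i ij; apply: N; rewrite ltnW.
  have muAD : mu (A `|` D) = (mu A + mu D)%E by apply: measureU => //; exact/eqP.
  have := mu_surv j e; rewrite AD muAD muD (mu_fin mA) -EFinD => -[] /(canRL (addrK _)) ->.
  by congr EFin; ring.
rewrite AD integral_setU //; last first.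
  by apply/measurable_EFinP/measurable_funTS/measurable_game.
rewrite integral_bigsetU_EFin //=; last 3 first.
- exact: enum_uniq.
- move=> z z' _ _ [w [[/(_ j.+1 (leqnn _)) + _] [/(_ j.+1 (leqnn _)) + _]]].
  by rewrite /update eqxx => -> .
- by apply/measurable_EFinP/measurable_funTS/(@measurable_game k.+1).
rewrite (eq_integral (cst (r (e j))%:E)) => [|w]; last first.
  rewrite inE => -[[Pw _] st] /=; rewrite Pw // asboolT //.
rewrite int_cst // muA.
under eq_bigr => z _.
  rewrite (eq_integral (fun w => (game k j.+1 w)%:E)) => [|w]; last first.
    rewrite inE => -[Pw Nw]; rewrite Pw ?leqW // eqe // asboolF //.
    by have := Nw j (ltnSn j); rewrite eqe.
  rewrite IH -/(weight _ _) weightS /update eqxx; over.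
rewrite sumEFin -EFinD big_enum /=; congr EFin.
rewrite [in RHS]mulrDr !mulr_sumr; congr (_ + _); first by ring.
by apply: eq_bigr => z _; ring.
Qed.

End Game.

(** * Two stopping rules: uniform thresholds and sets of states *)

Lemma uniform_prob_gt (R : realType) (a : R) : 0 <= a <= 1 ->
  uniform_prob (@ltr01 R) `]a, +oo[ = (1 - a)%:E.
Proof.
move=> /andP[a0 a1]; rewrite /uniform_prob integral_uniform_pdf.
rewrite (_ : _ `&` _ = `]a, 1]%classic); last first.
  apply/seteqP; split=> x /=; rewrite !in_itv /=.
    by move=> [/andP[-> _] /andP[_ ->]].
  move=> /andP[ax x1]; rewrite ax x1; split=> //.
  by rewrite andbT (le_trans a0) // ltW.
rewrite (eq_integral (cst 1%:E)) => [|x].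
  rewrite integral_cst //= lebesgue_measure_itv /= lte_fin mul1e.
  by case: ltP => // a1'; rewrite (_ : a = 1) ?subrr //; apply/le_anti/andP.
rewrite inE /= in_itv /= /uniform_pdf => /andP[ax x1].
by rewrite x1 (le_trans a0 (ltW ax)) subr0 invr1.
Qed.

Section Independence.
Context (R : realType) (E : finType) (d : measure_display)
  (Omega : measurableType d) (mu : probability Omega R).
Variables (X : nat -> Omega -> E) (Y : nat -> {mfun Omega >-> R}).

Definition threshold_stop (p : E -> R) n y : set Omega := [set w | Y n w <= p y].

Lemma measurable_threshold_stop p n y : measurable (threshold_stop p n y).
Proof.
rewrite (_ : threshold_stop p n y = Y n @^-1` `]-oo, p y]%classic).
  by rewrite -[_ @^-1` _]setTI; exact: measurable_funP.
by apply/seteqP; split=> w /=; rewrite in_itv.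
Qed.

(** The path event lies in [sigma_X]. The other event lies in [sigma_Y], being an intersection of
    independent events [Y i > p (e i)] of probability [1 - p (e i)]. *)
Lemma indep_threshold_stop (p : E -> R) n k (e : nat -> E) :
  strategy p -> iid_uniform mu Y -> independent_sequences mu X Y ->
  mu (path_event X n e `&` no_stop (threshold_stop p) k e) =
  (mu (path_event X n e) * (\prod_(i < k) (1 - p (e i)))%:E)%E.
Proof.
move=> strat [unif indep] XY.
pose B i : set R := `]p (e i), +oo[%classic.
have nsE : no_stop (threshold_stop p) k e =
    \bigcap_(i in [set` iota 0 k]) (Y i @^-1` B i).
  apply/seteqP; split=> w H i.
    rewrite /= mem_iota add0n => /H /negP; rewrite -ltNge => lt.
    by rewrite /B /= in_itv /= lt.
  move=> ik; have := H i; rewrite /B /= mem_iota add0n in_itv /= andbT => /(_ ik).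
  by rewrite ltNge => /negP.
rewrite XY.
- congr (_ * _)%E; rewrite nsE indep ?iota_uniq //; last by move=> i; exact: measurable_itv.
  rewrite -prodEFin.
  rewrite -(big_mkord xpredT (fun i => (1 - p (e i))%:E)) /index_iota subn0.
  apply: eq_bigr => i _; have := unif i (B i) (measurable_itv _).
  by rewrite uniform_prob_gt.
- rewrite (_ : path_event X n e =
    \bigcap_(i in [set i | (i <= n)%N]) (X i @^-1` [set e i])) //.
  apply: (@bigcap_measurableType _ (g_sigma_algebraType _)) => i _.
  apply: sub_sigma_algebra; exists i => //; exists [set e i] => //.
  by rewrite setTI.
- rewrite nsE.
  apply: (@bigcap_measurableType _ (g_sigma_algebraType _)) => i _.
  apply: sub_sigma_algebra; exists i => //; exists (B i); last by rewrite setTI.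
  exact: measurable_itv.
Qed.

(** A deterministic rule, with which absorption and, for [A := pred0], one-step expectations become
    instances of [game]. *)
Definition state_stop (A : pred E) (n : nat) y : set Omega := [set w | A y].

Lemma measurable_state_stop A n y : measurable (state_stop A n y).
Proof.
rewrite /state_stop; case: (A y).
  by rewrite (_ : [set w | _] = setT) //; apply/seteqP; split.
by rewrite (_ : [set w | _] = set0) //; apply/seteqP; split.
Qed.

(** If [e] meets [A] before time [k], both sides vanish; otherwise the rule never stops along [e]
    and all factors are 1. *)
Lemma indep_state_stop (A : pred E) n k (e : nat -> E) :
  mu (path_event X n e `&` no_stop (state_stop A) k e) =
  (mu (path_event X n e) * (\prod_(i < k) (1 - (A (e i))%:R))%:E)%E.
Proof.
have [/existsP[i Ai]|/existsPn no] := boolP [exists i : 'I_k, A (e i)].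
  rewrite (_ : _ `&` _ = set0); last first.
    by apply/seteqP; split=> // w [_ /(_ i (ltn_ord i))] /=.
  by rewrite measure0 (bigD1 i) //= Ai subrr mul0r mule0.
rewrite big1 ?mule1 => [|i _]; last by rewrite (negbTE (no i)) subr0.
congr (mu _); apply/seteqP; split=> w; first by case.
move=> Pw; split=> // i ik; exact/negP/(no (Ordinal ik)).
Qed.

End Independence.

(** * The transition operator killed on a set, and its contraction estimate *)

Section Killed.
Context (R : realType) (E : finType) (K : E -> E -> R) (A : pred E).
Hypothesis K_ge0 : forall x z, 0 <= K x z.
Hypothesis K_sum1 : forall x, \sum_z K x z = 1.

(** The substochastic operator of the chain killed on [A]; its iterates on the constant 1 are the
    probabilities of avoiding [A]. *)
Definition killed (v : E -> R) x : R := if A x then 0 else \sum_z K x z * v z.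

Lemma kernel_mean_bounded v M : (forall z, `|v z| <= M) ->
  forall x, `|\sum_z K x z * v z| <= M.
Proof.
move=> vM x; apply: (le_trans (ler_norm_sum _ _ _)).
rewrite -[leRHS]mul1r -(K_sum1 x) mulr_suml; apply: ler_sum => z _.
by rewrite normrM ger0_norm // ler_wpM2l.
Qed.

Lemma cvg_kernel_mean (T : Type) (F : set_system T) (FF : Filter F)
    (v : T -> E -> R) l x : (forall z, v t z @[t --> F] --> l z) ->
  \sum_z K x z * v t z @[t --> F] --> \sum_z K x z * l z.
Proof.
move=> vl; apply: cvg_big => [|z _]; first exact: add_continuous.
exact: cvgM (cvg_cst _) (vl z).
Qed.

Lemma le_killed u v : (forall x, u x <= v x) -> forall x, killed u x <= killed v x.
Proof.
move=> uv x; rewrite /killed; case: ifP => // _.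
by apply: ler_sum => z _; rewrite ler_wpM2l.
Qed.

Lemma le_iter_killed n u v : (forall x, u x <= v x) ->
  forall x, iter n killed u x <= iter n killed v x.
Proof. by move=> uv; elim: n => // n IH; exact: le_killed. Qed.

Lemma cvg_killed (T : Type) (F : set_system T) (FF : Filter F)
    (v : T -> E -> R) l x : (forall z, v t z @[t --> F] --> l z) ->
  killed (v t) x @[t --> F] --> killed l x.
Proof.
by move=> vl; rewrite /killed; case: ifP => _; [exact: cvg_cst|exact: cvg_kernel_mean].
Qed.

Lemma killedZ C v x : killed (fun z => C * v z) x = C * killed v x.
Proof.
rewrite /killed; case: ifP; rewrite ?mulr0 // => _; rewrite mulr_sumr.
by apply: eq_bigr => z _; ring.
Qed.

Lemma killed_shift v a x : 0 <= a -> killed (fun z => v z + a) x <= killed v x + a.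
Proof.
move=> a0; rewrite /killed; case: ifP => _; first by rewrite add0r.
under eq_bigr do rewrite mulrDr.
by rewrite big_split /= -mulr_suml K_sum1 mul1r.
Qed.

Lemma killed1_decr n m : (n <= m)%N ->
  forall x, iter m killed (fun=> 1) x <= iter n killed (fun=> 1) x.
Proof.
move=> /subnK <-; elim: (m - n)%N => // k IH x; apply: le_trans (IH x).
rewrite addSn iterSr; apply: le_iter_killed => z.
by rewrite /killed; case: ifP => // _; under eq_bigr do rewrite mulr1; rewrite K_sum1.
Qed.

(** Iterating the inequality [n] times costs [n * delta]. At a maximiser [y] of [v] the iterated
    operator gives at most [c * v y], so [(1 - c) * v y] is bounded by [n * delta]. *)
Lemma killed_subsolution n c v delta :
  (forall x, iter n killed (fun=> 1) x <= c) -> c < 1 ->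
  0 <= delta -> (forall x, 0 <= v x) ->
  (forall x, v x <= killed v x + delta) ->
  forall x, v x <= n%:R * delta / (1 - c).
Proof.
move=> nc c1 d0 v0 vsub x0.
have iter_sub k x : v x <= iter k killed v x + k%:R * delta.
  elim: k x => [|k IH] x /=; first by rewrite mul0r addr0.
  apply: (le_trans (vsub x)); rewrite mulrSr mulrDl mul1r addrA lerD2r.
  apply: (le_trans (le_killed IH x)); apply: killed_shift.
  by rewrite mulr_ge0.
pose y := [arg max_(x > x0) v x]%O.
have vy x : v x <= v y by rewrite /y; case: arg_maxP => // i _; apply.
have iterZ k x : iter k killed (fun=> v y * 1) x = v y * iter k killed (fun=> 1) x.
  elim: k x => //= k IH x; rewrite -killedZ /killed.
  by case: ifP => // _; apply: eq_bigr => z _; rewrite IH.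
apply: (le_trans (vy x0)); rewrite ler_pdivlMr ?subr_gt0 //.
have := iter_sub n y.
have : iter n killed v y <= v y * c.
  apply: (@le_trans _ _ (iter n killed (fun=> v y * 1) y)).
    by apply: le_iter_killed => x; rewrite mulr1.
  by rewrite iterZ ler_wpM2l.
by move=> h1 h2; rewrite mulrBr mulr1; lra.
Qed.

End Killed.

(** * Absorption of the chain in finite time *)

Section Absorption.
Context (R : realType) (E : finType) (d : measure_display)
  (Omega : measurableType d).
Variables (P : E -> probability Omega R) (X : nat -> Omega -> E).
Hypothesis hX : homogeneous_markov_chain P X.
Hypothesis habs : absorbing_chain P X.

Definition transition_prob x z : R := fine (transition P X x z).

Definition absorbing : pred E := fun y => `[< absorbing_state P X y >].

Lemma measurable_chain n y : measurable (X n @^-1` [set y]).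
Proof. by case: hX. Qed.

Lemma prob_fin x A : measurable A -> P x A = (fine (P x A))%:E.
Proof. by move=> mA; rewrite fineK // fin_num_measure. Qed.

Lemma transitionE x z : transition P X x z = (transition_prob x z)%:E.
Proof. exact/prob_fin/measurable_chain. Qed.

Lemma transition_prob_ge0 x z : 0 <= transition_prob x z.
Proof. exact: fine_ge0. Qed.

Lemma sum_state x n (B : set Omega) : measurable B ->
  P x B = (\sum_z P x (B `&` X n @^-1` [set z]))%E.
Proof.
move=> mB.
rewrite {1}(_ : B = \bigcup_(z in [set: E]) (B `&` X n @^-1` [set z])).
  rewrite measure_fin_bigcup; last 3 first.
  - exact: finite_finset.
  - by move=> z z' _ _ [w [[_ /= <-] [_ /= <-]]].
  - by move=> z _; apply: measurableI => //; exact: measurable_chain.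
  rewrite (fsbigE (enum E)) ?enum_uniq //; last by move=> z _; rewrite mem_enum.
  by rewrite big_enum_cond; apply: eq_bigl => z; rewrite in_setT.
by apply/seteqP; split=> w; [move=> Bw; exists (X n w)|case=> z _ []].
Qed.

Lemma transition_prob_sum1 x : \sum_z transition_prob x z = 1.
Proof.
have := sum_state x 1 measurableT.
under eq_bigr do rewrite setTI -/(transition P X x _) transitionE.
by rewrite probability_setT sumEFin => -[<-].
Qed.

Lemma markov_transition_prob x n e : P x (path_event X n.+1 e) =
  (P x (path_event X n e) * (transition_prob (e n) (e n.+1))%:E)%E.
Proof. by rewrite -transitionE; case: hX => _ _ mk; exact: mk. Qed.

Lemma transition_prob_absorbing y z : absorbing y -> transition_prob y z = (z == y)%:R.
Proof.
move=> /asboolP ay; have Kyy : transition_prob y y = 1 by rewrite /transition_prob ay.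
case: eqP => [->//|/eqP zy].
have := transition_prob_sum1 y; rewrite (bigD1 y) //= Kyy => /(canRL (addKr _)).
rewrite addNr => /eqP; rewrite psumr_eq0 => [/allP/(_ z)|i _]; last exact: transition_prob_ge0.
by rewrite mem_index_enum zy => /(_ isT)/eqP.
Qed.

Lemma integral_game_setT x stop p c r k :
  (forall n y, measurable (stop n y)) ->
  (forall n k e, P x (path_event X n e `&` no_stop stop k e) =
    (P x (path_event X n e) * (\prod_(i < k) (1 - p (e i)))%:E)%E) ->
  (\int[P x]_w (game X stop c r k 0 w)%:E = (game_value transition_prob p c r k x)%:E)%E.
Proof.
move=> mstop indep.
(* At time 0 only the first state of the path counts, so the constant path serves; its event
   [X 0 = x] has full mass under [P x]. *)
have := integral_game c r measurable_chain mstop (markov_transition_prob x) indep k 0 (fun=> x).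
have -> : path_event X 0 (fun=> x) = X 0 @^-1` [set x].
  apply/seteqP; split=> w; first exact.
  by move=> Xw i; rewrite leqn0 => /eqP ->.
have -> : no_stop stop 0 (fun=> x) = setT by apply/seteqP; split.
have X0 : P x (X 0 @^-1` [set x]) = 1%E by case: hX.
rewrite big_ord0 mulr1 setIT X0 mul1r => <-.
set S := X 0 @^-1` [set x].
have mS : measurable S by exact: measurable_chain.
have mg : measurable_fun setT (fun w => (game X stop c r k 0 w)%:E).
  by apply/measurable_EFinP/measurable_game => //; exact: measurable_chain.
rewrite -{1}(setUv S) integral_setU //; last 3 first.
- exact: measurableC.
- by rewrite setUv.
- by apply/disj_setPS => w [].
rewrite [X in (_ + X)%E]null_set_integral ?adde0 //.
- exact: measurableC.
- exact: measurable_funTS.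
- by rewrite [LHS](probability_setC (P x) mS) X0 subee.
Qed.

Definition unabsorbed n : set Omega :=
  [set w | forall i, (i <= n)%N -> ~~ absorbing (X i w)].

Lemma measurable_unabsorbed n : measurable (unabsorbed n).
Proof.
rewrite (_ : unabsorbed n = \bigcap_(i in [set i | (i <= n)%N])
    [set w | state_stop (predC absorbing) i (X i w) w]) //.
apply: bigcap_measurableType => i _.
apply: (measurable_slice measurable_chain) => y.
exact: measurable_state_stop.
Qed.

(** The indicator of [unabsorbed n] is the payoff of a game that pays 0 when stopped at an absorbing
    state and, at the horizon, 1 off the absorbing states. *)
Lemma prob_unabsorbed n x :
  P x (unabsorbed n) = (iter n.+1 (killed transition_prob absorbing) (fun=> 1) x)%:E.
Proof.
pose c y : R := (~~ absorbing y)%:R.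
have gE k j w : game X (state_stop absorbing) c (fun=> 0) k j w =
    \1_[set w | forall i, (j <= i <= j + k)%N -> ~~ absorbing (X i w)] w.
  elim: k j => [|k IH] j /=; rewrite indicE.
    rewrite /c; congr (_%:R); congr nat_of_bool; apply/idP/idP; rewrite inE /=.
      by move=> aX i; rewrite addn0 -eqn_leq => /eqP <-.
    by apply; rewrite addn0 leqnn.
  case: asboolP => [aX|/negP aX].
    rewrite memNset //= => /(_ j); rewrite leqnn leq_addr => /(_ isT).
    by rewrite aX.
  rewrite IH indicE; congr (_%:R); congr nat_of_bool; apply/idP/idP; rewrite !inE /=.
    move=> H i; rewrite leq_eqVlt => /andP[/orP[/eqP <-//|ji] ijk].
    by apply: H; rewrite ji addSnnS.
  by move=> H i /andP[ji ijk]; apply: H; rewrite ltnW // -addSnnS.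
have -> : iter n.+1 (killed transition_prob absorbing) (fun=> 1) x =
    game_value transition_prob (fun y => (absorbing y)%:R) c (fun=> 0) n x.
  elim: n x => [|n IH] x.
    rewrite /= /killed /c; case: (absorbing x) => //=.
    by under eq_bigr do rewrite mulr1; rewrite transition_prob_sum1.
  rewrite iterS /killed /= mulr0 add0r; case: (absorbing x).
    by rewrite subrr mul0r.
  by rewrite subr0 mul1r; apply: eq_bigr => z _; rewrite -IH.
rewrite -(@integral_game_setT x (state_stop absorbing)); last 2 first.
- exact: measurable_state_stop.
- exact: indep_state_stop.
under eq_integral do rewrite gE.
rewrite (_ : [set w | _] = unabsorbed n).
  by rewrite integral_indic ?setIT //; exact: measurable_unabsorbed.
by apply/seteqP; split=> w H i; [move=> ?|move=> /andP[_]]; exact: H.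
Qed.

(** From each state absorption has positive probability, so some iterate is below 1 there. The
    iterates decrease and [E] is finite, so one exponent and one bound serve all states. *)
Lemma exists_contraction : exists n c,
  [/\ c < 1 & forall x, iter n (killed transition_prob absorbing) (fun=> 1) x <= c].
Proof.
pose u n := iter n (killed transition_prob absorbing) (fun=> 1).
have u_lt1 x : exists n, u n x < 1.
  have [y [ay [n Pn]]] := habs x; exists n.+1.
  rewrite -lte_fin -prob_unabsorbed.
  have mXn := measurable_chain n y.
  apply: (@le_lt_trans _ _ (P x (~` (X n @^-1` [set y])))).
    apply: le_measure; rewrite ?inE; first exact: measurable_unabsorbed.
      exact: measurableC.
    by move=> w /(_ n (leqnn n)) /negP H Xn; apply: H; rewrite Xn; apply/asboolP.
  have -> : P x (~` (X n @^-1` [set y])) = (1 - P x (X n @^-1` [set y]))%E.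
    exact: probability_setC.
  by move: Pn; rewrite (prob_fin x mXn) -EFinB lte_fin lte_fin; lra.
pose m := (\max_(x : E) ex_minn (u_lt1 x))%N.
exists m, (\big[Num.max/0]_x u m x); split; last by move=> x; exact: le_bigmax.
apply/bigmax_ltP; split=> // x _.
have : u (ex_minn (u_lt1 x)) x < 1 by case: ex_minnP.
apply: le_lt_trans; apply: killed1_decr; [exact: transition_prob_ge0|exact: transition_prob_sum1|].
exact: (leq_bigmax_cond (F := fun x => ex_minn (u_lt1 x))).
Qed.

(** The probability of never being absorbed, as a function of the starting state, is a fixed point
    of the killed operator, hence zero by [killed_subsolution] with [delta] equal to 0. *)
Lemma ae_absorbed x :
  {ae P x, forall w, exists n, absorbing (X n w)}.
Proof.
pose N := \bigcap_n unabsorbed n.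
have mN : measurable N by apply: bigcap_measurableType => n _; exact: measurable_unabsorbed.
have cvN y : iter n.+1 (killed transition_prob absorbing) (fun=> 1) y @[n --> \oo] --> fine (P y N).
  apply: (@fine_cvg _ _ _ _ (fun n => (iter n.+1 (killed transition_prob absorbing) (fun=> 1) y)%:E)).
  rewrite -(prob_fin y mN); under eq_fun do rewrite -prob_unabsorbed.
  apply: nonincreasing_cvg_mu => //.
  - by rewrite [ltLHS]prob_unabsorbed ltry.
  - exact: measurable_unabsorbed.
  - by move=> n m nm; apply/subsetPset => w H i ni; apply: H; exact: leq_trans nm.
have subN y : fine (P y N) <= killed transition_prob absorbing (fun y => fine (P y N)) y + 0.
  rewrite addr0 le_eqVlt; apply/orP; left; apply/eqP.
  apply: (@cvg_unique _ _ (iter n.+2 (killed transition_prob absorbing) (fun=> 1) y @[n --> \oo])) => //.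
    by have := cvN y; rewrite -cvg_shiftS.
  exact: cvg_killed.
exists N; split => //; last first.
  by move=> w /= H n _ i _; apply/negP => aX; apply: H; exists i.
have [n [c [c1 nc]]] := exists_contraction.
have := killed_subsolution transition_prob_ge0 transition_prob_sum1 nc c1 (lexx 0) (fun y => fine_ge0 (measure_ge0 (P y) N)) subN x.
rewrite mulr0 mul0r => le0; rewrite (prob_fin x mN); congr EFin.
by apply/le_anti; rewrite le0 fine_ge0.
Qed.

(** The exceptional event is a finite union of path events whose last transition leaves an absorbing
    state and has probability zero. *)
Lemma ae_absorbed_stays x n :
  {ae P x, forall w, absorbing (X n w) -> X n.+1 w = X n w}.
Proof.
(* Paths up to time [n + 1] are indexed by a finite type: the states at times 0 to [n], and the
   final state. *)
pose F (tz : {ffun 'I_n.+1 -> E} * E) :=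
  path_event X n.+1 (fun i => if (i <= n)%N then tz.1 (inord i) else tz.2).
pose D := [set tz : {ffun 'I_n.+1 -> E} * E | absorbing (tz.1 ord_max) /\ tz.2 != tz.1 ord_max].
exists (\bigcup_(tz in D) F tz); split.
- apply: fin_bigcup_measurable => [|tz _]; first exact: finite_finset.
  exact: measurable_path_event measurable_chain _ _.
- rewrite [LHS](measure_fin_bigcup (P x)); last 3 first.
  + exact: finite_finset.
  + move=> [t z] [t' z'] _ _ [w [/= Hw Hw']]; congr (_, _).
      apply/ffunP => i; have iin : (i <= n)%N by rewrite -ltnS.
      by have := Hw i (leqW iin); rewrite (Hw' i (leqW iin)) iin inord_val.
    by have := Hw _ (leqnn _); rewrite (Hw' _ (leqnn _)) ltnn.
  + by move=> tz _; exact: measurable_path_event measurable_chain _ _.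
  rewrite fsbig1 // => -[t z] [/= at_ zt].
  rewrite [LHS]markov_transition_prob leqnn ltnn.
  have -> : inord n = ord_max :> 'I_n.+1 by apply: val_inj; rewrite /= inordK.
  by rewrite transition_prob_absorbing // (negbTE zt) mule0.
- move=> w /= /not_implyP[aX /eqP XX]; exists ([ffun i : 'I_n.+1 => X i w], X n.+1 w).
    by rewrite /D /= ffunE.
  move=> i /=; rewrite leq_eqVlt ltnS => /orP[/eqP ->|ij]; first by rewrite ltnn.
  by rewrite ij ffunE inordK.
Qed.

Lemma ae_eventually_constant x :
  {ae P x, forall w, exists n, forall m, X (m + n)%N w = X n w}.
Proof.
have := ae_foralln (fun n => ae_absorbed_stays x n).
have := ae_absorbed x; apply: filterS2 => w [n an] stay; exists n.
by elim=> // m IH; rewrite addSn stay IH.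
Qed.

End Absorption.

(** A bounded sequence converges exactly when its upper and lower limits agree, and both are
    measurable. Elsewhere [limn] takes the default value [point], a constant. *)
Lemma measurable_limn (R : realType) (d : measure_display) (T : measurableType d)
    (u : nat -> T -> R) (M : R) : (forall n, measurable_fun setT (u n)) ->
  (forall n w, `|u n w| <= M) -> measurable_fun setT (fun w => limn (u ^~ w)).
Proof.
move=> mu uM.
have ubu w : has_ubound (range (u ^~ w)).
  by exists M => _ [n _ <-]; apply: le_trans (ler_norm _) (uM n w).
have lbu w : has_lbound (range (u ^~ w)).
  by exists (- M) => _ [n _ <-]; have := uM n w; rewrite ler_norml => /andP[].
have ubNu w : has_ubound (range (fun n => - u n w)).
  by exists M => _ [n _ <-]; have := uM n w; rewrite ler_norml lerNl => /andP[].
have lbNu w : has_lbound (range (fun n => - u n w)).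
  by exists (- M) => _ [n _ <-]; rewrite lerN2; apply: le_trans (ler_norm _) (uM n w).
have msup : measurable_fun setT (fun w => limn_sup (u ^~ w)).
  exact: measurable_fun_limn_sup.
have minf : measurable_fun setT (fun w => - limn_sup (fun n => - u n w)).
  apply: measurableT_comp => //; apply: measurable_fun_limn_sup => // n.
  exact: measurableT_comp.
rewrite (_ : (fun w => limn (u ^~ w)) = fun w =>
    if limn_sup (u ^~ w) == - limn_sup (fun n => - u n w)
    then limn_sup (u ^~ w) else point).
  by apply: measurable_fun_ifT => //; exact: measurable_fun_eqr.
apply: funext => w; case: eqP => [supinf|neq].
  apply/cvg_lim => //.
  have le_sups (v : R^nat) n : has_ubound (range v) -> v n <= sups v n.
    move=> ubv; apply: ub_le_sup; first exact: has_ubound_sdrop.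
    by exists n => /=.
  apply: (@squeeze_cvgr _ _ _ _ (fun n => - sups (fun n => - u n w) n) (sups (u ^~ w))).
  - near=> n; rewrite le_sups // andbT lerNl.
    exact: (le_sups (fun n => - u n w)).
  - rewrite supinf; apply: cvgN.
    rewrite -/(cvgn _); apply/cvg_ex; eexists; exact: cvg_sups_inf.
  - apply/cvg_ex; eexists; exact: cvg_sups_inf.
rewrite dvgP // => cu; apply: neq; rewrite cvg_limn_supE //.
have -> : (fun n => - u n w) = \- (u ^~ w) by [].
rewrite cvg_limn_supE; last exact: is_cvgN.
by rewrite limN // opprK.
Unshelve. all: by end_near. Qed.

(** * Values of strategies: recursion, bounds and continuity *)

Section Value.
Context (R : realType) (E : finType) (d : measure_display)
  (Omega : measurableType d).
Variables (P : E -> probability Omega R) (X : nat -> Omega -> E)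
  (Y : nat -> {mfun Omega >-> R}).
Hypothesis hX : homogeneous_markov_chain P X.
Hypothesis habs : absorbing_chain P X.
Hypothesis hY : forall x, iid_uniform (P x) Y.
Hypothesis hXY : forall x, independent_sequences (P x) X Y.

Lemma expect_next x (v : E -> R) :
  expect P x (v \o X 1%N) = \sum_z transition_prob P X x z * v z.
Proof.
rewrite /expect unlock.
rewrite (eq_integral (fun w => (game X (state_stop pred0) v v 1 0 w)%:E)) => [|w _].
  rewrite (integral_game_setT hX (p := fun=> 0)) /=; last 2 first.
  - exact: measurable_state_stop.
  - by move=> n k e; have := indep_state_stop (P x) X pred0 n k e.
  by rewrite mul0r add0r subr0 mul1r.
by rewrite /= asboolF.
Qed.

Section Strategy.
Variables (p : E -> R) (f : E -> R).
Hypothesis strat : strategy p.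

(** Stopping truncated at time [k], with [f] also paid at the horizon: on unstopped paths the
    payoffs are [f (X k w)], which matches the convention at infinity. *)
Let G k w := game X (threshold_stop Y p) f f k 0 w.

Lemma game_skip m k j w :
  (forall i, (j <= i < j + m)%N -> ~ Y i w <= p (X i w)) ->
  game X (threshold_stop Y p) f f (m + k) j w =
  game X (threshold_stop Y p) f f k (j + m) w.
Proof.
elim: m j => [|m IH] j nstop; first by rewrite addn0.
rewrite addSn /= asboolF; last by apply: nstop; rewrite leqnn addnS ltnS leq_addr.
rewrite IH ?addnS // => i /andP[ji ijm]; apply: nstop.
by rewrite ltnW //= addnS.
Qed.

Lemma near_game_stopped n w : Y n w <= p (X n w) ->
  (forall m, Y m w <= p (X m w) -> (n <= m)%N) ->
  \forall k \near \oo, G k w = f (X n w).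
Proof.
move=> Yn minY.
near=> k; have -> : k = (n + (k - n.+1).+1)%N.
  by rewrite -subSn ?subSS ?subnKC //; near: k; exists n.+1 => // m /=; exact: ltnW.
rewrite /G game_skip => [|i]; first by rewrite add0n /= asboolT.
by rewrite add0n => /andP[_ /[swap] /minY]; rewrite leqNgt => /negP.
Unshelve. all: by end_near. Qed.

Lemma game_unstopped k w : (~ exists n, Y n w <= p (X n w)) -> G k w = f (X k w).
Proof.
move=> nex; rewrite -[k in LHS]addn0 /G game_skip //.
by move=> i _ Yi; apply: nex; exists i.
Qed.

(** Holds at every [w], even where no limit exists: on unstopped paths both sides are [limn] of the
    same sequence, and on stopped paths [G] is eventually constant. *)
Lemma stopped_valueE w : stopped_value X Y f p w = limn (G ^~ w).
Proof.
rewrite /stopped_value /stopping_time; case: pselect => [ex|nex].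
  case: ex_minnP => n Yn minY; apply/esym/norm_lim_near_cst.
  exact: near_game_stopped.
by congr (limn _); apply: funext => k; rewrite game_unstopped.
Qed.

Lemma ae_cvg_game x : {ae P x, forall w, G k w @[k --> \oo] --> stopped_value X Y f p w}.
Proof.
apply: filterS (ae_eventually_constant hX habs x) => w [n Xn].
rewrite stopped_valueE; suff : cvgn (G ^~ w) by [].
have [ex|nex] := pselect (exists m, Y m w <= p (X m w)).
  case: (ex_minnP ex) => m Ym minY.
  exact: is_cvg_near_cst (near_game_stopped Ym minY).
apply: (@is_cvg_near_cst _ _ (f (X n w))); near=> k.
rewrite game_unstopped // -(@subnK n k) ?Xn //; near: k; exact: nbhs_infty_ge.
Unshelve. all: by end_near. Qed.

(** Dominated convergence for the truncated games, which are bounded by the maximum of [|f|] and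
    converge almost surely because the chain is eventually constant. *)
Lemma cvg_game_value x :
  game_value (transition_prob P X) p f f k x @[k --> \oo] --> value P X Y f p x.
Proof.
pose M := \big[Num.max/0]_y `|f y|.
have fM y : `|f y| <= M by exact: le_bigmax.
have mstop := measurable_threshold_stop Y p.
have mG k : measurable_fun setT (G k).
  exact: measurable_game (measurable_chain hX) mstop _ _.
have GM k w : `|G k w| <= M by exact: game_bounded.
have mS : measurable_fun setT (stopped_value X Y f p).
  rewrite (_ : stopped_value X Y f p = fun w => limn (G ^~ w)); last first.
    by apply: funext => w; rewrite stopped_valueE.
  exact: measurable_limn GM.
have cvGE : {ae P x, forall w, setT w ->
    (G k w)%:E @[k --> \oo] --> (stopped_value X Y f p w)%:E}.
  apply: filterS (ae_cvg_game x) => w Gw _.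
  by apply/fine_cvgP; split; [exact: nearW|exact: Gw].
have ig : (P x).-integrable setT (EFin \o cst M).
  exact: finite_measure_integrable_cst.
have leM : {ae P x, forall w k, setT w -> (`|(G k w)%:E| <= (EFin \o cst M) w)%E}.
  by apply: aeW => w k _; rewrite /= lee_fin.
have [iS _] := dominated_convergence measurableT
  (fun k => (measurable_EFinP _ _).2 (mG k)) ((measurable_EFinP _ _).2 mS) cvGE ig leM.
rewrite /value /expect unlock => cvG.
have GE k : (\int[P x]_w (G k w)%:E)%E = (game_value (transition_prob P X) p f f k x)%:E.
  apply: integral_game_setT => // n i e.
  exact: indep_threshold_stop.
apply: (@fine_cvg _ _ _ _ (fun k => (game_value (transition_prob P X) p f f k x)%:E)).
rewrite -(_ : [sequence (\int[P x]_w (G k w)%:E)%E]_k =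
  (fun k => (game_value (transition_prob P X) p f f k x)%:E)); last first.
  by apply: funext => k; exact: GE.
by rewrite fineK // (integrable_fin_num measurableT iS).
Qed.

(** The recursion of [game_value] passes to the limit in the horizon. *)
Lemma valueE x : value P X Y f p x =
  p x * f x + (1 - p x) * \sum_z transition_prob P X x z * value P X Y f p z.
Proof.
apply: (@cvg_unique _ _ (game_value (transition_prob P X) p f f k.+1 x @[k --> \oo])) => //.
  by have := @cvg_game_value x; rewrite -cvg_shiftS.
apply: cvgD; first exact: cvg_cst.
apply: cvgM; first exact: cvg_cst.
by apply: cvg_kernel_mean => z; exact: cvg_game_value.
Qed.

(** When [p y] is 0 the recursion [valueE] is a tautology at an absorbing [y], so the value is read
    off the finite horizons. *)
Lemma value_absorbing y : absorbing P X y -> value P X Y f p y = f y.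
Proof.
move=> ay; apply: (@cvg_unique _ _ (game_value (transition_prob P X) p f f k y @[k --> \oo])) => //.
  exact: cvg_game_value.
have gE k : game_value (transition_prob P X) p f f k y = f y.
  elim: k => //= k IH.
  rewrite (bigD1 y) //= big1 ?addr0 => [|z zy].
    by rewrite transition_prob_absorbing // eqxx mul1r IH; ring.
  by rewrite transition_prob_absorbing // (negbTE zy) mul0r.
by apply: cvg_near_cst; apply: nearW => k; exact: gE.
Qed.

Lemma value_bounded M : (forall x, `|f x| <= M) -> forall x, `|value P X Y f p x| <= M.
Proof.
move=> fM x.
have cv : `|game_value (transition_prob P X) p f f k x| @[k --> \oo]
    --> `|value P X Y f p x|.
  by apply: cvg_norm; exact: cvg_game_value.
have -> : `|value P X Y f p x| =
    limn (fun k => `|game_value (transition_prob P X) p f f k x|).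
  by apply/esym/cvg_lim.
apply: limr_le; first by apply/cvg_ex; eexists; exact: cv.
apply: nearW => k /=; elim: k x {cv} => //= k IH x.
have /andP[p0] := strat x; rewrite -subr_ge0 => p1.
apply: (le_trans (ler_normD _ _)); rewrite !normrM (ger0_norm p0) (ger0_norm p1).
have mM := kernel_mean_bounded (transition_prob_ge0 P X) (transition_prob_sum1 hX) IH x.
apply: (@le_trans _ _ (p x * M + (1 - p x) * M)); last by rewrite -mulrDl subrKC mul1r.
by apply: lerD; rewrite ler_wpM2l.
Qed.

End Strategy.

(** The distance between the two values is a subsolution for the killed operator, with an error
    proportional to the distance of the strategies; [killed_subsolution] bounds it. *)
Lemma exists_value_lipschitz (f : E -> R) : exists C, forall p p', strategy p -> strategy p' ->
  forall x, `|value P X Y f p x - value P X Y f p' x| <= C * \sum_y `|p y - p' y|.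
Proof.
have [n [c [c1 nc]]] := exists_contraction hX habs.
pose M := \big[Num.max/0]_y `|f y|.
have fM y : `|f y| <= M by exact: le_bigmax.
have M0 : 0 <= M by exact: bigmax_ge_id.
exists (n%:R * (M + M) / (1 - c)) => p p' sp sp' x.
set v := fun x => `|value P X Y f p x - value P X Y f p' x|.
set delta := \sum_y `|p y - p' y|.
have d0 : 0 <= delta by exact: sumr_ge0.
rewrite -/(v x) mulrAC -(mulrA n%:R (M + M) delta).
apply: (killed_subsolution (transition_prob_ge0 P X) (transition_prob_sum1 hX) nc c1) => //.
  by rewrite mulr_ge0 // addr_ge0.
  by move=> y; exact: normr_ge0.
move=> {}x; rewrite /killed; have [ax|nax] := boolP (absorbing P X x).
  by rewrite /v !value_absorbing // subrr normr0 add0r mulr_ge0 // addr_ge0.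
rewrite /v.
set m := \sum_z transition_prob P X x z * value P X Y f p z.
set m' := \sum_z transition_prob P X x z * value P X Y f p' z.
have m'M : `|m'| <= M.
  have vM := value_bounded sp' fM.
  have := kernel_mean_bounded (transition_prob_ge0 P X) (transition_prob_sum1 hX) vM.
  by apply.
(* The first summand is controlled by the killed operator. In the second, [f x - m'] is at most
   [M + M] in absolute value, which explains the constant. *)
have -> : value P X Y f p x - value P X Y f p' x =
    (1 - p x) * (m - m') + (f x - m') * (p x - p' x).
  by rewrite (valueE f sp) (valueE f sp') -/m -/m'; ring.
apply: (le_trans (ler_normD _ _)); rewrite !normrM; apply: lerD.
  have p1 : 0 <= 1 - p x by rewrite subr_ge0; case/andP: (sp x).
  rewrite (ger0_norm p1).
  apply: (@le_trans _ _ (1 * `|m - m'|)); first by rewrite ler_wpM2r // gerBl; case/andP: (sp x).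
  rewrite mul1r /m /m' -sumrB; apply: (le_trans (ler_norm_sum _ _ _)).
  apply: ler_sum => z _; rewrite -mulrBr normrM ger0_norm //.
  exact: transition_prob_ge0.
apply: ler_pM => //.
  by apply: (le_trans (ler_normB _ _)); apply: lerD.
by rewrite /delta (bigD1 x) //= lerDl sumr_ge0.
Qed.

Lemma cvg_value (f : E -> R) (F : set_system nat) (FF : Filter F) (u : nat -> E -> R) p x :
  (forall n, strategy (u n)) -> strategy p ->
  (forall y, u n y @[n --> F] --> p y) ->
  value P X Y f (u n) x @[n --> F] --> value P X Y f p x.
Proof.
move=> su sp up; have [C lip] := exists_value_lipschitz f.
apply: cvg_zero; apply: norm_cvg0.
apply: (@squeeze_cvgr _ _ _ _ (cst 0) (fun n => C * \sum_y `|u n y - p y|)).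
- by apply: nearW => n; rewrite normr_ge0; exact: lip.
- exact: cvg_cst.
rewrite -[X in _ --> X](_ : C * \sum_(y : E) `|p y - p y| = 0); last first.
  by rewrite big1 ?mulr0 // => y _; rewrite subrr normr0.
have sum0 : \sum_y `|u n y - p y| @[n --> F] --> \sum_(y : E) `|p y - p y|.
  apply: cvg_big => [|y _]; first exact: add_continuous.
  by apply: cvg_norm; apply: cvgB => //; exact: cvg_cst.
exact: cvgM (cvg_cst _) sum0.
Qed.

End Value.

(** * Existence of equilibria *)

(** Compactness yields a cluster point, and an ultrafilter converges to each of its cluster
    points. *)
Lemma ultra_cvg_unit (R : realType) (T : Type) (F : set_system T) (c : T -> R) :
  UltraFilter F -> (forall t, 0 <= c t <= 1) ->
  exists2 l : R, 0 <= l <= 1 & c t @[t --> F] --> l.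
Proof.
move=> UF c01.
have [l [l01 cl]] : `[0, 1] `&` cluster (c @ F) !=set0.
  by apply: segment_compact; apply: nearW => t; rewrite /= in_itv /= c01.
exists l; first by move: l01; rewrite /= in_itv.
move=> A lA; have [//|nA] := in_ultra_setVsetC (c @^-1` A) UF.
by have [x []] := cl (~` A) A nA lA.
Qed.

(* Nash's theorem for players choosing a point of [0, 1]. Grid points are labelled
   by the direction in which the player's payoff does not increase; Kuhn's lemma
   and a vanishing mesh give a point where neither direction is profitable. *)
Lemma exists_coordinatewise_max (R : realType) (E : finType)
    (obj : (E -> R) -> E -> R -> R) :
  (forall (F : set_system nat) (FF : ProperFilter F) (u : nat -> E -> R) p
      (q : nat -> R) l x,
    (forall n, strategy (u n)) -> strategy p ->
    (forall y, u n y @[n --> F] --> p y) -> q n @[n --> F] --> l ->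
    obj (u n) x (q n) @[n --> F] --> obj p x l) ->
  (forall p x a c t, strategy p -> 0 <= t <= 1 ->
    t * obj p x a + (1 - t) * obj p x c <= obj p x (t * a + (1 - t) * c)) ->
  exists p, strategy p /\ forall q x, 0 <= q <= 1 -> obj p x q <= obj p x (p x).
Proof.
move=> cont conc.
pose pt n (z : E -> nat) : E -> R := fun y => (z y)%:R / n.+1%:R.
pose low p x := forall q, 0 <= q <= 1 -> q <= p x -> obj p x q <= obj p x (p x).
pose upp p x := forall q, 0 <= q <= 1 -> p x <= q -> obj p x q <= obj p x (p x).
(* The labels forced on the boundary are sound: [low] is trivial at coordinate 0 and [upp] at
   coordinate 1. *)
pose lab n x (z : E -> nat) : bool :=
  if z x == 0%N then false else if z x == n.+1 then true
  else ~~ `[< low (pt n z) x >].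
have pt01 n z : (forall y, (z y <= n.+1)%N) -> strategy (pt n z).
  move=> zn y; rewrite /pt divr_ge0 //= ler_pdivrMr ?ltr0n // mul1r.
  by rewrite ler_nat.
have lab_low n x z : lab n x z = false -> low (pt n z) x.
  rewrite /lab; case: eqP => [z0 _ q /andP[q0 q1] qz|_].
    have : pt n z x = 0 by rewrite /pt z0 mul0r.
    by move=> e; have -> : q = pt n z x by apply/le_anti; rewrite qz e q0.
  by case: eqP => // _ /negbFE/asboolP.
have lab_upp n x z : (forall y, (z y <= n.+1)%N) -> lab n x z = true -> upp (pt n z) x.
  move=> zn; have sz := pt01 n z zn; rewrite /lab; case: eqP => // _; case: eqP => [z1 _ q /andP[q0 q1] qz|_].
    have : pt n z x = 1 by rewrite /pt z1 divff.
    by move=> e; have -> : q = pt n z x by apply/le_anti; rewrite qz e q1.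
  (* If a lower point [r] and a higher point [q] both paid more than [b], then concavity would fail
     at [b], which is their convex combination with weight [t] on [r]. *)
  move=> /asboolPn nlow q /andP[q0 q1] qz; rewrite leNgt; apply/negP => qgt.
  apply: nlow => r /andP[r0 r1] rz; rewrite leNgt; apply/negP => rgt.
  set b := pt n z x in qz qgt rz rgt.
  have rb : r < b by rewrite lt_neqAle rz andbT; apply: contraTneq rgt => ->; rewrite ltxx.
  have bq : b < q by rewrite lt_neqAle qz andbT; apply: contraTneq qgt => ->; rewrite ltxx.
  have qr : 0 < q - r by lra.
  pose t := (q - b) / (q - r).
  have t0 : 0 < t by rewrite divr_gt0 // subr_gt0.
  have t1 : 0 < 1 - t.
    by rewrite subr_gt0 ltr_pdivrMr // mul1r; lra.
  have bE : b = t * r + (1 - t) * q.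
    have : t * (q - r) = q - b by rewrite /t divfK // gt_eqF.
    by move=> tE; lra.
  have t01 : 0 <= t <= 1 by apply/andP; split; lra.
  have := conc _ x r q t sz t01; rewrite -bE leNgt => /negP; apply.
  have -> : obj (pt n z) x b = t * obj (pt n z) x b + (1 - t) * obj (pt n z) x b by ring.
  by apply: ltrD; rewrite ltr_pM2l.
have ex n : exists z, (forall y, (z y < n.+1)%N) /\ forall x, exists u v,
    [/\ forall y, (z y <= u y <= (z y).+1)%N, forall y, (z y <= v y <= (z y).+1)%N,
    lab n x u = false & lab n x v = true].
  apply: kuhn_cubical => x z zx; rewrite /lab zx //=.
  by rewrite eqxx.
have [z zP] := choice ex.
have exu n x : exists u, (forall y, (z n y <= u y <= (z n y).+1)%N) /\ low (pt n u) x.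
  have [zn /(_ x)[u [v [zu zv lu lv]]]] := zP n.
  by exists u; split => //; exact: lab_low.
have exv n x : exists v, (forall y, (z n y <= v y <= (z n y).+1)%N) /\ upp (pt n v) x.
  have [zn /(_ x)[u [v [zu zv lu lv]]]] := zP n.
  exists v; split => //; apply: lab_upp => // y.
  by have /andP[_ /leq_trans] := zv y; apply; exact: zn.
have strat_near n (w : E -> nat) : (forall y, (z n y <= w y <= (z n y).+1)%N) ->
    strategy (pt n w).
  move=> zw; apply: pt01 => y; have /andP[_ /leq_trans] := zw y; apply.
  by have [+ _] := zP n; apply.
(* Along an ultrafilter all coordinates of the grid points converge at once, with no successive
   extraction of subsequences. *)
have [G [UG sG]] := @ultraFilterLemma nat \oo _.
have sz n : strategy (pt n (z n)) by apply: strat_near => y; rewrite leqnn leqnSn.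
have exl x : exists l : R, 0 <= l <= 1 /\ pt n (z n) x @[n --> G] --> l.
  have [|l l01 cl] := @ultra_cvg_unit _ _ G (fun n => pt n (z n) x) _.
    by move=> n; exact: sz.
  by exists l.
have [p pP] := choice exl.
have sp : strategy p by move=> x; have [] := pP x.
(* The vertices of the cube found for [n] differ by at most [1 / (n + 1)] in each coordinate, so
   every choice of vertices converges to the same [p]. *)
have near_cvg (w : nat -> E -> nat) : (forall n y, (z n y <= w n y <= (z n y).+1)%N) ->
    forall y, pt n (w n) y @[n --> G] --> p y.
  move=> zw y; have [_ cz] := pP y.
  apply: (@squeeze_cvgr _ _ _ _ (fun n => pt n (z n) y)
    (fun n => pt n (z n) y + n.+1%:R^-1)) => //.
    apply: nearW => n; have /andP[zw1 zw2] := zw n y.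
    have -> : pt n (z n) y + n.+1%:R^-1 = (z n y).+1%:R / n.+1%:R.
      by rewrite -(natr1 (z n y)) mulrDl mul1r.
    by rewrite !ler_pM2r ?invr_gt0 ?ltr0n // !ler_nat zw1.
  rewrite -[p y]addr0; apply: cvgD => //.
  apply: cvg_trans cvg_harmonic; exact: cvg_app.
exists p; split=> // q x q01.
have [u uP] := choice (fun n => exu n x).
have [v vP] := choice (fun n => exv n x).
have cu := near_cvg u (fun n => (uP n).1).
have cv := near_cvg v (fun n => (vP n).1).
have su n := strat_near n _ (uP n).1.
have sv n := strat_near n _ (vP n).1.
(* A deviation below [p x] is eventually below the vertices [u n], where [low] applies; one above
   [p x] is treated with [upp] at [v n]. Both inequalities pass to the limit. *)
have [qp|pq|->//] := ltgtP q (p x).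
  apply: (ler_cvg_to (cont G _ _ _ (fun=> q) q x su sp cu (cvg_cst _))
    (cont G _ _ _ (fun n => pt n (u n) x) (p x) x su sp cu (cu x))).
  apply: filterS (cvgr_gt _ (cu x) _ qp) => n /ltW qn.
  exact: (uP n).2.
apply: (ler_cvg_to (cont G _ _ _ (fun=> q) q x sv sp cv (cvg_cst _))
  (cont G _ _ _ (fun n => pt n (v n) x) (p x) x sv sp cv (cv x))).
apply: filterS (cvgr_lt _ (cv x) _ pq) => n /ltW qn.
exact: (vP n).2.
Qed.

Lemma concave_functionP (R : realType) (g : R -> R) : concave_function g ->
  forall a b t, 0 <= t <= 1 -> t * g a + (1 - t) * g b <= g (t * a + (1 - t) * b).
Proof.
move=> cg a b t /andP[t0 t1].
have : - g (t * a + (1 - t) * b) <= t * - g a + (1 - t) * - g b.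
  exact: (cg (Itv01 t0 t1) a b (in_setT _) (in_setT _)).
by lra.
Qed.

Theorem corollary4p4 (R : realType) (E : finType)
  (d : measure_display) (Omega : measurableType d)
  (P : E -> probability Omega R)
  (X : nat -> Omega -> E) (Y : nat -> {mfun Omega >-> R})
  (f h : E -> R) (g : R -> R)
  (hX : homogeneous_markov_chain P X)
  (habs : absorbing_chain P X)
  (hY : forall x, iid_uniform (P x) Y)
  (hXY : forall x, independent_sequences (P x) X Y)
  (g_cont : continuous g)
  (g_concave : concave_function g) :
  exists p : E -> R, equilibrium P X Y f h g p.
Proof.
pose next u p x := \sum_z transition_prob P X x z * value P X Y u p z.
pose mix u p x q := q * u x + (1 - q) * next u p x.
pose obj p x q := mix f p x q + g (mix h p x q).
have cvg_mix u (F : set_system nat) (FF : ProperFilter F) (p_ : nat -> E -> R) p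
    (q : nat -> R) l x : (forall n, strategy (p_ n)) -> strategy p ->
    (forall y, p_ n y @[n --> F] --> p y) -> q n @[n --> F] --> l ->
    mix u (p_ n) x (q n) @[n --> F] --> mix u p x l.
  move=> sp_ sp cp cq; apply: cvgD; first by apply: cvgM => //; exact: cvg_cst.
  apply: cvgM; first by apply: cvgB => //; exact: cvg_cst.
  apply: cvg_kernel_mean => z.
  exact: cvg_value.
have [|p_ x a c t _ t01|p [sp pmax]] := @exists_coordinatewise_max R E obj.
- move=> F FF p_ p q l x sp_ sp cp cq.
  apply: cvgD; first exact: cvg_mix.
  apply: continuous_cvg; [exact: g_cont|exact: cvg_mix].
(* Since [mix] is affine in [q], concavity of [obj] in [q] comes from that of [g]. *)
- have := concave_functionP g_concave (mix h p_ x a) (mix h p_ x c) t01.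
  rewrite /obj; have mixE u : mix u p_ x (t * a + (1 - t) * c) =
    t * mix u p_ x a + (1 - t) * mix u p_ x c by rewrite /mix; ring.
  rewrite !mixE; lra.
exists p; split=> // q x q01.
rewrite !(expect_next hX) /reward.
have mixp u : value P X Y u p x = mix u p x (p x) by exact: valueE.
by rewrite !mixp; exact: pmax.
Qed.
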